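(* Let $\delta t>0$ and, given $(\phi^{n-1},\rho^{n-1},U^{n-1},V^{n-1},W^{n-1})$ and $(\phi^n,\rho^n,U^n,V^n,W^n)$, let $(\phi^{n+1},\mu_\phi^{n+1},\rho^{n+1},\mu_\rho^{n+1},U^{n+1},V^{n+1},W^{n+1})$ satisfy, with periodic boundary conditions, the second order linear scheme $$\frac{3\phi^{n+1}-4\phi^n+\phi^{n-1}}{2\delta t}=M_1\Delta\mu_\phi^{n+1},$$ $$\mu_\phi^{n+1}=-\epsilon\Delta\phi^{n+1}+\frac1\epsilon\phi^\star U^{n+1}+\alpha\nabla\cdot(V^{n+1}\boldsymbol Z^\star),$$ $$\frac{3\rho^{n+1}-4\rho^n+\rho^{n-1}}{2\delta t}=M_2\Delta\mu_\rho^{n+1},$$ $$\mu_\rho^{n+1}=\alpha V^{n+1}+\beta H^\star W^{n+1},$$ $$3U^{n+1}-4U^n+U^{n-1}=2\phi^\star(3\phi^{n+1}-4\phi^n+\phi^{n-1}),$$ $$3V^{n+1}-4V^n+V^{n-1}=(3\rho^{n+1}-4\rho^n+\rho^{n-1})-\boldsymbol Z^\star\cdot\nabla(3\phi^{n+1}-4\phi^n+\phi^{n-1}),$$ $$3W^{n+1}-4W^n+W^{n-1}=\frac12H^\star(3\rho^{n+1}-4\rho^n+\rho^{n-1}),$$ where $\phi^\star=2\phi^n-\phi^{n-1}$, $\boldsymbol Z^\star=\boldsymbol Z(2\phi^n-\phi^{n-1})$, $H^\star=H(2\rho^n-\rho^{n-1})$. Then the scheme is unconditionally energy stable, i.e.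 for every time step size $\delta t>0$ the following discrete energy dissipation law holds: $$\frac1{\delta t}\big(E_{2nd}^{n+1,n}-E_{2nd}^{n,n-1}\big)\le-M_1\|\nabla\mu_\phi^{n+1}\|^2-M_2\|\nabla\mu_\rho^{n+1}\|^2,$$ where $$E_{2nd}^{n+1,n}=\frac\epsilon2\Big(\frac12\|\nabla\phi^{n+1}\|^2+\frac12\|2\nabla\phi^{n+1}-\nabla\phi^n\|^2\Big)+\frac1{4\epsilon}\Big(\frac12\|U^{n+1}\|^2+\frac12\|2U^{n+1}-U^n\|^2\Big)$$ $$\qquad+\frac\alpha2\Big(\frac12\|V^{n+1}\|^2+\frac12\|2V^{n+1}-V^n\|^2\Big)+\beta\Big(\frac12\|W^{n+1}\|^2+\frac12\|2W^{n+1}-W^n\|^2\Big),$$ and $E_{2nd}^{n,n-1}$ is given by the same formula with $(n+1,n)$ replaced by $(n,n-1)$.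
   Context: $\Omega$ is a rectangular periodic box in $\mathbb R^d$, $d=2,3$ (e.g. $[0,2\pi]^d$); $(f,g)=\int_\Omega fg\,d\boldsymbol x$, $\|f\|=\sqrt{(f,f)}$. All functions are periodic on $\Omega$; $\phi^k,\mu_\phi^k,\mu_\rho^k\in H^1_{per}(\Omega)$ and $\rho^k,U^k,V^k,W^k\in L^2_{per}(\Omega)$, and the equations containing $\Delta$ or $\nabla\cdot$ are understood in the weak sense, tested against functions in $H^1_{per}(\Omega)$, integrating by parts with no boundary terms. The parameters $\epsilon,\alpha,\beta,M_1,M_2$ are positive constants. $\boldsymbol Z(\phi)=\nabla\phi/|\nabla\phi|$, with the convention $\boldsymbol Z(\phi)=0$ where $\nabla\phi=0$. $H(\rho)=\dfrac{g(\rho)}{\sqrt{G(\rho)+B}}$ with $g=G'$, where $G:\mathbb R\to\mathbb R$ is the regularized Flory–Huggins potential: for a fixed small $\widehat\epsilon\in(0,1/2)$, $$G(\rho)=\begin{cases}\rho\ln\rho+\frac{(1-\rho)^2}{2\widehat\epsilon}+(1-\rho)\ln\widehat\epsilon-\frac{\widehat\epsilon}{2},&\rho\ge1-\widehat\epsilon,\\ \rho\ln\rho+(1-\rho)\ln(1-\rho),&\widehat\epsilon\le\rho\le1-\widehat\epsilon,\\ (1-\rho)\ln(1-\rho)+\frac{\rho^2}{2\widehat\epsilon}+\rho\ln\widehat\epsilon-\frac{\widehat\epsilon}{2},&\rho\le\widehat\epsilon,\end{cases}$$ and $B>0$ is a constant such that $G(\rho)+B>0$ for all $\rho$ (e.g.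 $B=1$). *)

(* Defs.v *)
From HB Require Import structures.
From mathcomp Require Import all_boot all_order all_algebra.
From mathcomp Require Import all_classical all_reals all_analysis.
From mathcomp Require Import measurable_realfun ess_sup_inf.

Set Implicit Arguments.
Unset Strict Implicit.
Unset Printing Implicit Defensive.
Import Order.TTheory GRing.Theory Num.Theory.
Import numFieldNormedType.Exports.

Local Open Scope classical_set_scope.
Local Open Scope ring_scope.

(* The product sigma-algebra on row vectors; for real entries it is the Borel
   sigma-algebra, see open_measurable_rV. *)
Definition measure_rV_display : measure_display -> measure_display.
Proof. exact. Qed.

Section measurable_rV.
Context {d} {T : measurableType d} {n : nat}.

Let coord (i : 'I_n) (x : 'rV[T]_n) : T := x 0 i.

Let rV_set0 : g_sigma_preimage coord set0.
Proof. exact: sigma_algebra0. Qed.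

Let rV_setC A : g_sigma_preimage coord A -> g_sigma_preimage coord (~` A).
Proof. exact: sigma_algebraC. Qed.

Let rV_bigcup (F : (set 'rV[T]_n)^nat) :
  (forall i, g_sigma_preimage coord (F i)) ->
  g_sigma_preimage coord (\bigcup_i (F i)).
Proof. exact: sigma_algebra_bigcup. Qed.

HB.instance Definition _ := @isMeasurable.Build (measure_rV_display d)
  'rV[T]_n (g_sigma_preimage coord) rV_set0 rV_setC rV_bigcup.

End measurable_rV.

Lemma measurable_coord d (T : measurableType d) n (i : 'I_n) :
  measurable_fun [set: 'rV[T]_n] (fun x => x 0 i).
Proof.
move=> _ Y mY; rewrite setTI; apply: sub_sigma_algebra => /=.
rewrite -bigcup_seq/=; exists i => /=; first by rewrite mem_index_enum.
by exists Y => //; rewrite setTI.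
Qed.

Lemma measurable_fun_rV d1 d2 (T1 : measurableType d1) (T2 : measurableType d2)
    n (f : T1 -> 'rV[T2]_n) :
  (forall i, measurable_fun [set: T1] (fun x => f x 0 i)) ->
  measurable_fun [set: T1] f.
Proof.
move=> mf _ A mA; rewrite setTI.
suff: g_sigma_preimage (fun i => (fun x : 'rV[T2]_n => x 0 i) \o f) `<=` measurable.
  apply; rewrite g_sigma_preimage_comp/=; exists A => //; exact: setTI.
apply: smallest_sub; first exact: sigma_algebra_measurable.
move=> B; rewrite -bigcup_seq => -[i _ [C mC <-]].
exact: mf.
Qed.

(* Lebesgue measure on R^(n+1) as the image of the product of the Lebesgue
   measures on R and R^n. *)
Section cons_measure.
Context (R : realType) (n : nat).

Definition cons_rV (p : R * 'rV[R]_n) : 'rV[R]_n.+1 :=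
  \row_i (if unlift ord0 i is Some j then p.2 0 j else p.1).

Definition uncons_rV (v : 'rV[R]_n.+1) : R * 'rV[R]_n :=
  (v 0 0, \row_j v 0 (lift ord0 j)).

Lemma cons_rVK : cancel cons_rV uncons_rV.
Proof.
case=> x y; rewrite /uncons_rV; congr pair; first by rewrite mxE unlift_none.
by apply/rowP => j; rewrite !mxE liftK.
Qed.

Lemma uncons_rVK : cancel uncons_rV cons_rV.
Proof.
by move=> v; apply/rowP => i; rewrite mxE; case: unliftP => [j|] -> //; rewrite mxE.
Qed.

Lemma measurable_cons_rV : measurable_fun [set: R * 'rV[R]_n] cons_rV.
Proof.
apply: measurable_fun_rV => i; rewrite /cons_rV.
under eq_fun do rewrite mxE.
case: unliftP => [j|] _; last exact: measurable_fst.
have mj : measurable_fun [set: 'rV[R]_n] (fun x => x 0 j).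
  exact: measurable_coord.
exact: (measurableT_comp mj (@measurable_snd _ _ R 'rV[R]_n)).
Qed.

Lemma measurable_uncons_rV : measurable_fun [set: 'rV[R]_n.+1] uncons_rV.
Proof.
apply: measurable_fun_pair; first exact: measurable_coord.
apply: measurable_fun_rV => j; under eq_fun do rewrite mxE.
exact: measurable_coord.
Qed.

Variable m : {sigma_finite_measure set 'rV[R]_n -> \bar R}.

Definition cons_measure : set 'rV[R]_n.+1 -> \bar R :=
  pushforward (@lebesgue_measure R \x m)%E cons_rV.

Let cons_measure0 : cons_measure set0 = 0%E.
Proof. by rewrite /cons_measure /pushforward preimage_set0 measure0. Qed.

Let measurable_cons_preimage A :
  measurable A -> measurable (cons_rV @^-1` A).
Proof. by move=> mA; rewrite -[X in measurable X]setTI; exact: measurable_cons_rV. Qed.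

Let cons_measure_ge0 A : (0 <= cons_measure A)%E.
Proof. by rewrite /cons_measure /pushforward integral_ge0. Qed.

Let cons_measure_sigma_additive : semi_sigma_additive cons_measure.
Proof.
move=> F mF tF mUF; rewrite /cons_measure /pushforward preimage_bigcup.
apply: measure_semi_sigma_additive.
- by move=> k; exact: measurable_cons_preimage.
- apply/trivIsetP => /= i j _ _ ij; rewrite -preimage_setI.
  by move/trivIsetP : tF => /(_ _ _ _ _ ij) ->//; rewrite preimage_set0.
- by rewrite -preimage_bigcup; exact: measurable_cons_preimage.
Qed.

HB.instance Definition _ := isMeasure.Build _ _ _ cons_measure
  cons_measure0 cons_measure_ge0 cons_measure_sigma_additive.

Let cons_measure_sigma_finite : sigma_finite setT cons_measure.
Proof.
have /sigma_finiteP[F [TF ndF Foo]] := sigma_finiteT (@lebesgue_measure R).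
have /sigma_finiteP[G [TG ndG Goo]] := sigma_finiteT m.
exists (fun k => uncons_rV @^-1` (F k `*` G k)) => [|k].
  apply/seteqP; split=> // v _.
  have [i _ Fi] : (\bigcup_i F i) (uncons_rV v).1 by rewrite -TF.
  have [j _ Gj] : (\bigcup_i G i) (uncons_rV v).2 by rewrite -TG.
  exists (maxn i j) => //; split.
    by apply: (subsetPset _ _ (ndF _ _ (leq_maxl i j))).
  by apply: (subsetPset _ _ (ndG _ _ (leq_maxr i j))).
have [mF Fk] := Foo k; have [mG Gk] := Goo k; split.
  rewrite -[X in measurable X]setTI; apply: measurable_uncons_rV => //.
  exact: measurableX.
rewrite /cons_measure /pushforward (_ : _ @^-1` _ = F k `*` G k).
  by rewrite product_measure1E// lte_mul_pinfty// ge0_fin_numE.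
apply/funext => p.
by rewrite -[LHS]/((F k `*` G k) (uncons_rV (cons_rV p))) cons_rVK.
Qed.

HB.instance Definition _ := Measure_isSigmaFinite.Build _ _ _ cons_measure
  cons_measure_sigma_finite.

End cons_measure.

Fixpoint lebesgue_rV (R : realType) (n : nat) :
    {sigma_finite_measure set 'rV[R]_n -> \bar R} :=
  if n is n'.+1 then cons_measure (lebesgue_rV R n') else \d_(0 : 'rV[R]_0).

Record box (R : realType) (d : nat) := Box {
  lower : 'rV[R]_d;
  upper : 'rV[R]_d;
  lower_lt_upper : forall i, lower 0 i < upper 0 i }.

Definition box_set (R : realType) (d : nat) (Q : box R d) : set 'rV[R]_d :=
  [set x | forall i, x 0 i \in `[lower Q 0 i, upper Q 0 i]].

Lemma measurable_box_gen (R : realType) (d : nat) (a b : 'rV[R]_d) :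
  measurable [set x : 'rV[R]_d | forall i, x 0 i \in `[a 0 i, b 0 i]].
Proof.
rewrite (_ : mkset _ = \bigcap_(i in [set: 'I_d])
    ((fun x : 'rV[R]_d => x 0 i) @^-1` `[a 0 i, b 0 i])).
  apply: fin_bigcap_measurable => [|i _]; first exact: finite_finset.
  rewrite -[X in measurable X]setTI; apply: measurable_coord => //.
by apply/seteqP; split=> [x h i _|x h i]; [exact: h|exact: (h i)].
Qed.

Lemma measurable_box (R : realType) (d : nat) (Q : box R d) :
  measurable (box_set Q).
Proof. exact: measurable_box_gen. Qed.

Lemma lebesgue_rV_box_gen (R : realType) (d : nat) (a b : 'rV[R]_d) :
  (forall i, a 0 i < b 0 i) ->
  lebesgue_rV R d [set x | forall i, x 0 i \in `[a 0 i, b 0 i]] =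
  (\prod_i (b 0 i - a 0 i))%:E.
Proof.
elim: d a b => [|d IH] a b ab.
  by rewrite big_ord0 /= diracE mem_set// => -[].
rewrite big_ord_recl /=.
pose a' := (uncons_rV a).2; pose b' := (uncons_rV b).2.
rewrite /cons_measure /pushforward.
rewrite (_ : _ @^-1` _ = `[a 0 0, b 0 0]%classic `*`
    [set x : 'rV[R]_d | forall i, x 0 i \in `[a' 0 i, b' 0 i]]).
  rewrite product_measure1E//; last exact: measurable_box_gen.
  rewrite IH; last by move=> i; rewrite !mxE.
  have E : lebesgue_measure (`[a 0 0, b 0 0]%classic : set R) = (b 0 0 - a 0 0)%:E.
    by rewrite lebesgue_measure_itv/= lte_fin ab EFinB.
  rewrite EFinM; congr (_ * _)%E; first exact: E.
  by congr _%:E; apply: eq_bigr => i _; rewrite !mxE.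
apply/seteqP; split=> [[x y] /= h|[x y] [/= hx hy] i].
  split; first by have := h ord0; rewrite mxE unlift_none.
  by move=> i; have := h (lift ord0 i); rewrite !mxE liftK.
by rewrite mxE; case: unliftP => [j|] -> //; have := hy j; rewrite !mxE.
Qed.

Lemma lebesgue_rV_box (R : realType) (d : nat) (Q : box R d) :
  lebesgue_rV R d (box_set Q) = (\prod_i (upper Q 0 i - lower Q 0 i))%:E.
Proof. exact/lebesgue_rV_box_gen/lower_lt_upper. Qed.

Definition box_measure (R : realType) (d : nat) (Q : box R d) :
  set 'rV[R]_d -> \bar R := mrestr (lebesgue_rV R d) (measurable_box Q).

Section box_measure.
Context (R : realType) (d : nat) (Q : box R d).

HB.instance Definition _ := Measure.on (box_measure Q).

Let box_measure_fin : fin_num_fun (box_measure Q).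
Proof.
apply: lty_fin_num_fun.
have E : box_measure Q setT = lebesgue_rV R d (box_set Q).
  by rewrite /box_measure /mrestr/= setTI.
by have := ltry (\prod_i (upper Q 0 i - lower Q 0 i)); rewrite -lebesgue_rV_box -E.
Qed.

HB.instance Definition _ := Measure_isFinite.Build _ _ _ (box_measure Q)
  box_measure_fin.

End box_measure.

Lemma open_measurable_rV (R : realType) (d : nat) (U : set 'rV[R]_d) :
  open U -> measurable U.
Proof.
move=> oU.
pose cube (q : 'rV[rat]_d * nat) : set 'rV[R]_d :=
  [set x | forall i, `|ratr (q.1 0 i) - x 0 i| < q.2.+1%:R^-1].
have mcube q : measurable (cube q).
  rewrite (_ : cube q = \bigcap_(i in [set: 'I_d]) ((fun x : 'rV[R]_d => x 0 i)
      @^-1` [set t | `|ratr (q.1 0 i) - t| < q.2.+1%:R^-1])).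
    apply: fin_bigcap_measurable => [|i _]; first exact: finite_finset.
    rewrite -[X in measurable X]setTI; apply: measurable_coord => //.
    rewrite (_ : mkset _ = ball (ratr (q.1 0 i) : R) q.2.+1%:R^-1)//.
    exact: measurable_ball.
  by apply/seteqP; split=> [x h i _|x h i]; [exact: h|exact: (h i)].
pose F k := if unpickle k is Some q then
  if `[< cube q `<=` U >] then cube q else set0 else set0.
rewrite (_ : U = \bigcup_k F k).
  apply: bigcupT_measurable => k; rewrite /F.
  by case: unpickle => [q|//]; case: ifP.
apply/seteqP; split=> [x Ux|x [k _]]; last first.
  by rewrite /F; case: unpickle => [q|//]; case: asboolP => [qU qx|//]; exact: qU.
have /nbhs_ballP[e /= e0 eU] : nbhs x U by exact: open_nbhs_nbhs.
have [k ke] : exists k : nat, 2 * k.+1%:R^-1 < e.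
  have e20 : 0 < e / 2 by rewrite divr_gt0.
  have [k _ hk] := near_infty_natSinv_lt (PosNum e20).
  by exists k; rewrite mulrC -ltr_pdivlMr//; exact: (hk k (leqnn k)).
have k0 : 0 < k.+1%:R^-1 :> R by rewrite invr_gt0.
have /choice[q hq] (i : 'I_d) : exists q : rat, `|ratr q - x 0 i| < k.+1%:R^-1.
  have : x 0 i - k.+1%:R^-1 < x 0 i + k.+1%:R^-1 by rewrite ltrBlDr -addrA ltrDl addr_gt0.
  by move=> /rat_in_itvoo[q]; rewrite in_itv/= => hq; exists q; rewrite ltr_distl.
exists (pickle (\row_i q i, k)) => //; rewrite /F pickleK asboolT.
  by move=> i /=; rewrite mxE; exact: hq.
move=> y hy; apply: eU; split=> // i j; rewrite (ord1 i) /ball/=.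
apply: lt_trans ke; rewrite mulr_natl mulr2n.
have := hy j; rewrite /= mxE => hyj.
rewrite (le_lt_trans (ler_distD (ratr (q j)) _ _))// ltrD//.
by rewrite distrC.
Qed.

Section euclidean.
Context (R : realType) (d : nat).

Definition dotv (u v : 'rV[R]_d) : R := \sum_i u 0 i * v 0 i.

(* The library norm `|p| on row vectors is the maximum norm, hence the explicit
   Euclidean norm. *)
Definition Z (p : 'rV[R]_d) : 'rV[R]_d :=
  if p == 0 then 0 else (Num.sqrt (dotv p p))^-1 *: p.

End euclidean.

Section periodic_spaces.
Context (R : realType) (d : nat) (Q : box R d).
Implicit Types (f g : 'rV[R]_d -> R) (F : 'rV[R]_d -> 'rV[R]_d).

Definition periodic (T : Type) (f : 'rV[R]_d -> T) :=
  forall x i, f (x + (upper Q 0 i - lower Q 0 i) *: delta_mx 0 i) = f x.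

Definition partial (i : 'I_d) f : 'rV[R]_d -> R :=
  fun x => 'D_(delta_mx 0 i) f x.

Fixpoint Ck (k : nat) f : Prop :=
  continuous f /\
  if k is k'.+1 then
    forall i, (forall x, derivable f x (delta_mx 0 i)) /\ Ck k' (partial i f)
  else True.

Definition test_function f := periodic f /\ forall k, Ck k f.

(* Elements are measurable functions, not classes modulo a.e. equality. *)
Definition L2per_pred : {pred 'rV[R]_d -> R} :=
  fun f => `[< periodic f /\ f \in Lfun (box_measure Q) 2%:E >].

Definition weak_gradient f F :=
  forall psi, test_function psi -> forall i,
    \int[box_measure Q]_x (f x * partial i psi x) =
    - \int[box_measure Q]_x (F x 0 i * psi x).

Definition H1per_pred :
    {pred (('rV[R]_d -> R) * ('rV[R]_d -> 'rV[R]_d))%type} :=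
  fun p => `[< [/\ p.1 \in L2per_pred,
                   forall i, (fun x => p.2 x 0 i) \in L2per_pred &
                   weak_gradient p.1 p.2] >].

Lemma L2per_submod_closed : submod_closed L2per_pred.
Proof.
have [L0 LD] := Lfun_submod_closed (box_measure Q) (lee1n 2).
split; first by apply/asboolP.
move=> a f g /asboolP[pf lf] /asboolP[pg lg]; apply/asboolP; split.
  by move=> x i; rewrite -[LHS]/(a * f _ + g _) pf pg.
exact: LD.
Qed.

HB.instance Definition _ := GRing.isSubmodClosed.Build _ _ L2per_pred
  L2per_submod_closed.

Lemma continuous_Lfun f : continuous f -> f \in Lfun (box_measure Q) 2%:E.
Proof.
move=> cf.
have mf : measurable_fun [set: 'rV[R]_d] f.
  apply: (measurability _ (RGenOpens.measurableE R)) => _ [_ [a [b ->] <-]].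
  rewrite setTI; apply: open_measurable_rV; apply: open_comp => [x _|].
    exact: cf.
  exact: interval_open.
have cpt : compact (box_set Q).
  apply: (@rV_compact _ _ (fun i => `[lower Q 0 i, upper Q 0 i]%classic)).
  by move=> i; exact: segment_compact.
have /compact_bounded[M [_ fM]] : compact (f @` box_set Q).
  by apply: continuous_compact => //; exact: continuous_subspaceT.
have Qoo : box_measure Q [set: 'rV[R]_d] \is a fin_num by exact: fin_num_measure.
apply: (@Lfun_subset _ _ _ (box_measure Q) 2%:E +oo%E) => //.
- exact: lee1n.
- by rewrite leey.
- by rewrite leey.
rewrite inE; apply/andP; split; rewrite inE//= /finite_norm unlock /Lnorm; case: ifPn => // _.
apply: (@le_lt_trans _ _ (M + 1)%:E); last by rewrite ltry.
apply/ess_supP; exists (~` box_set Q); split.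
- by apply: measurableC; exact: measurable_box.
- transitivity (lebesgue_rV R d set0); last exact: measure0.
  by rewrite -(setICl (box_set Q)).
- move=> x /= + Qx; apply.
  by rewrite lee_fin; apply: (fM (M + 1)); [rewrite ltrDl|exists x].
Qed.

Lemma integrable_mul2 f g : f \in Lfun (box_measure Q) 2%:E ->
  g \in Lfun (box_measure Q) 2%:E ->
  (box_measure Q).-integrable setT (EFin \o (fun x => f x * g x)).
Proof. by move=> lf lg; apply/Lfun1_integrable; exact: Lfun2_mul_Lfun1. Qed.

Lemma test_function_Lfun psi : test_function psi ->
  psi \in Lfun (box_measure Q) 2%:E /\
  forall i, partial i psi \in Lfun (box_measure Q) 2%:E.
Proof.
move=> [_ Cpsi]; split=> [|i]; first exact: continuous_Lfun (Cpsi 0%N).1.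
by apply: continuous_Lfun; have [_ /(_ i)[_ []]] := Cpsi 1%N.
Qed.

Lemma Rintegral_lincomb a f g psi :
  f \in Lfun (box_measure Q) 2%:E -> g \in Lfun (box_measure Q) 2%:E ->
  psi \in Lfun (box_measure Q) 2%:E ->
  \int[box_measure Q]_x ((a * f x + g x) * psi x) =
  a * \int[box_measure Q]_x (f x * psi x) + \int[box_measure Q]_x (g x * psi x).
Proof.
move=> lf lg lpsi.
under eq_Rintegral do rewrite mulrDl -mulrA.
rewrite RintegralD//; [|exact: integrableZl (integrable_mul2 _ _)|exact: integrable_mul2].
by rewrite RintegralZl//; exact: integrable_mul2.
Qed.

Lemma H1per_submod_closed : submod_closed H1per_pred.
Proof.
have [L0 LD] := L2per_submod_closed.
split.
  apply/asboolP; split=> //.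
    move=> i; rewrite (_ : (fun _ => _) = 0)//.
    by apply/funext => x; rewrite -[LHS]/((0 : 'rV[R]_d) 0 i) mxE.
  move=> psi _ i; under eq_Rintegral do rewrite mul0r.
  under [in RHS]eq_Rintegral do rewrite -[X in X * _]/((0 : 'rV[R]_d) 0 i) mxE mul0r.
  by rewrite /Rintegral integral0 oppr0.
move=> a p q /asboolP[p1 p2 wp] /asboolP[q1 q2 wq]; apply/asboolP; split.
- exact: LD.
- move=> i; rewrite (_ : (fun _ => _) =
    a *: (fun x => p.2 x 0 i) + (fun x => q.2 x 0 i)); first exact: LD.
  by apply/funext => x; rewrite -[LHS]/((a *: p.2 x + q.2 x) 0 i) !mxE.
- move=> psi tpsi i; have [lpsi lDpsi] := test_function_Lfun tpsi.
  move: p1 q1 (p2 i) (q2 i) => /asboolP[_ lp1] /asboolP[_ lq1].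
  move=> /asboolP[_ lp2] /asboolP[_ lq2].
  rewrite -[LHS]/(\int[box_measure Q]_x
    ((a * p.1 x + q.1 x) * partial i psi x)) Rintegral_lincomb//.
  under [in RHS]eq_Rintegral do
    rewrite -[X in X * _]/((a *: p.2 _ + q.2 _) 0 i) mxE [X in (X + _) * _]mxE.
  by rewrite Rintegral_lincomb// wp// wq// mulrN opprD.
Qed.

HB.instance Definition _ := GRing.isSubmodClosed.Build _ _ H1per_pred
  H1per_submod_closed.

Record L2per := { L2fun :> 'rV[R]_d -> R; _ : L2fun \in L2per_pred }.

HB.instance Definition _ := [isSub for L2fun].
HB.instance Definition _ := [Choice of L2per by <:].
HB.instance Definition _ := [SubChoice_isSubLmodule of L2per by <:].

(* An element of H^1_per carries a representative of its weak gradient. *)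
Record H1per := {
  H1pair : (('rV[R]_d -> R) * ('rV[R]_d -> 'rV[R]_d))%type;
  _ : H1pair \in H1per_pred }.

HB.instance Definition _ := [isSub for H1pair].
HB.instance Definition _ := [Choice of H1per by <:].
HB.instance Definition _ := [SubChoice_isSubLmodule of H1per by <:].

Definition H1fun (u : H1per) : 'rV[R]_d -> R := (H1pair u).1.
Coercion H1fun : H1per >-> Funclass.

Definition grad (u : H1per) : 'rV[R]_d -> 'rV[R]_d := (H1pair u).2.

Definition inner f g : R := \int[box_measure Q]_x (f x * g x).

Definition norm f : R := Num.sqrt (inner f f).

Definition innerv F G : R := \int[box_measure Q]_x (dotv (F x) (G x)).

Definition normv F : R := Num.sqrt (innerv F F).

Record state := State { phi : H1per; rho : L2per; U : L2per; V : L2per; W : L2per }.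

End periodic_spaces.

(* The branches agree at eh and 1 - eh. *)
Definition flory_huggins (R : realType) (eh r : R) : R :=
  if 1 - eh <= r then
    r * ln r + (1 - r) ^+ 2 / (2 * eh) + (1 - r) * ln eh - eh / 2
  else if eh <= r then
    r * ln r + (1 - r) * ln (1 - r)
  else
    (1 - r) * ln (1 - r) + r ^+ 2 / (2 * eh) + r * ln eh - eh / 2.

Definition H (R : realType) (eh B r : R) : R :=
  derive1 (flory_huggins eh) r / Num.sqrt (flory_huggins eh r + B).

Section scheme.
Context (R : realType) (d : nat) (Q : box R d).

(* With time levels n-1, n, n+1 given by s0, s1, s2. The equations with a
   Laplacian or a divergence are weak; d <= 3 makes (phi* U) psi integrable for
   every psi in H^1_per, by Sobolev embedding. *)
Record bdf2_scheme (eps alpha beta M1 M2 eh B dt : R) (s0 s1 s2 : state Q)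
    (mu_phi mu_rho : H1per Q) : Prop := {
  phi_eq : forall psi : H1per Q,
    inner Q ((2 * dt)^-1 *: (3 *: phi s2 - 4 *: phi s1 + phi s0) : H1per Q) psi =
    - M1 * innerv Q (grad mu_phi) (grad psi);
  mu_phi_eq : forall psi : H1per Q,
    inner Q mu_phi psi =
    eps * innerv Q (grad (phi s2)) (grad psi)
    + eps^-1 * inner Q (fun x => (2 *: phi s1 - phi s0 : H1per Q) x * U s2 x) psi
    - alpha * innerv Q
        (fun x => V s2 x *: Z (grad (2 *: phi s1 - phi s0) x)) (grad psi);
  rho_eq : forall psi : H1per Q,
    inner Q ((2 * dt)^-1 *: (3 *: rho s2 - 4 *: rho s1 + rho s0) : L2per Q) psi =
    - M2 * innerv Q (grad mu_rho) (grad psi);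
  mu_rho_eq : {ae box_measure Q, forall x,
    mu_rho x =
    alpha * V s2 x + beta * H eh B (2 * rho s1 x - rho s0 x) * W s2 x};
  U_eq : {ae box_measure Q, forall x,
    3 * U s2 x - 4 * U s1 x + U s0 x =
    2 * (2 * phi s1 x - phi s0 x) *
      (3 * phi s2 x - 4 * phi s1 x + phi s0 x)};
  V_eq : {ae box_measure Q, forall x,
    3 * V s2 x - 4 * V s1 x + V s0 x =
    (3 * rho s2 x - 4 * rho s1 x + rho s0 x)
    - dotv (Z (grad (2 *: phi s1 - phi s0) x))
           (grad (3 *: phi s2 - 4 *: phi s1 + phi s0) x)};
  W_eq : {ae box_measure Q, forall x,
    3 * W s2 x - 4 * W s1 x + W s0 x =
    2^-1 * H eh B (2 * rho s1 x - rho s0 x) *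
      (3 * rho s2 x - 4 * rho s1 x + rho s0 x)} }.

Definition energy (eps alpha beta : R) (s' s : state Q) : R :=
  eps / 2 * (2^-1 * normv Q (grad (phi s')) ^+ 2
             + 2^-1 * normv Q (2 *: grad (phi s') - grad (phi s)) ^+ 2)
  + (4 * eps)^-1 * (2^-1 * norm Q (U s') ^+ 2
                    + 2^-1 * norm Q (2 *: U s' - U s : L2per Q) ^+ 2)
  + alpha / 2 * (2^-1 * norm Q (V s') ^+ 2
                 + 2^-1 * norm Q (2 *: V s' - V s : L2per Q) ^+ 2)
  + beta * (2^-1 * norm Q (W s') ^+ 2
            + 2^-1 * norm Q (2 *: W s' - W s : L2per Q) ^+ 2).

End scheme.

(* Main.v *)
Require Import Defs.
From mathcomp Require Import all_boot all_order all_algebra.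
From mathcomp Require Import all_classical all_reals all_analysis.
From mathcomp Require Import measurable_realfun lra ring.

(** The auxiliary unknowns U, V, W make the energy quadratic, so the scheme is
    stable for the same reason as the second order backward difference formula
    applied to a linear gradient flow. Write D a for 3 a^(n+1) - 4 a^n + a^(n-1).

    Testing the two evolution equations with mu_phi and mu_rho turns the
    dissipation into the pairings of the chemical potentials with D phi and
    D rho. Testing the equation of mu_phi with D phi and multiplying that of
    mu_rho by D rho expresses the same pairings through the nonlinear terms.
    The update rules of U, V, W are the chain rule for these terms: phi* U D phi
    and H* W D rho become U D U / 2 and 2 W D W, and the two occurrences of
    alpha V, in the two chemical potentials, add up to alpha V D V
    ([inner_phistar_U], [innerv_VZ], [inner_mu_rho]). What remains
    ([energy_balance]) equates 2 dt times the dissipation with a combination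
    of the pairings of each energy variable a, at the new time, with D a.

    Each pairing bounds a difference of energies, because
    [2 a (3 a - 4 b + c) = a^2 + (2 a - b)^2 - b^2 - (2 b - c)^2
                           + (a - 2 b + c)^2],
    integrated in [bdf2_le_norm] and [bdf2_le_normv]. Adding these bounds with
    the weights of the energy gives the dissipation law.

    The products phi* U D phi, V Z* . grad (D phi) and H* W D rho have three
    factors; their integrability comes from the update rules, by which they
    agree almost everywhere with products of two square integrable functions. *)

Set Implicit Arguments.
Unset Strict Implicit.
Unset Printing Implicit Defensive.
Import Order.TTheory GRing.Theory Num.Theory.
Import numFieldNormedType.Exports.

Local Open Scope classical_set_scope.
Local Open Scope ring_scope.

(** * Integrals of real functions *)

Section integral_lemmas.
Context d (T : measurableType d) (R : realType).
Context (mu : {measure set T -> \bar R}).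

Lemma ae_eq_Rintegral (f g : T -> R) :
  measurable_fun setT f -> measurable_fun setT g ->
  {ae mu, forall x, f x = g x} -> \int[mu]_x f x = \int[mu]_x g x.
Proof.
move=> mf mg fg; rewrite /Rintegral; congr fine; apply: ae_eq_integral => //.
- exact/measurable_EFinP.
- exact/measurable_EFinP.
- by apply: filterS fg => x /= fgx _; rewrite fgx.
Qed.

Lemma integrable_scale (k : R) (f : T -> R) :
  mu.-integrable setT (EFin \o f) ->
  mu.-integrable setT (EFin \o (fun x => k * f x)).
Proof. exact: integrableZl. Qed.

(** The shape of an energy difference: two squares at the new time minus two
    squares at the old one. *)
Lemma le_Rintegral_sumB (p q r s t : T -> R) :
  mu.-integrable setT (EFin \o p) -> mu.-integrable setT (EFin \o q) ->
  mu.-integrable setT (EFin \o r) -> mu.-integrable setT (EFin \o s) ->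
  mu.-integrable setT (EFin \o t) ->
  (forall x, p x + q x - (r x + s x) <= t x) ->
  \int[mu]_x p x + \int[mu]_x q x - (\int[mu]_x r x + \int[mu]_x s x)
    <= \int[mu]_x t x.
Proof.
move=> ip iq ir is_ it le_t.
have ipq : mu.-integrable setT (EFin \o (fun x => p x + q x)).
  exact: (integrableD measurableT ip iq).
have irs : mu.-integrable setT (EFin \o (fun x => r x + s x)).
  exact: (integrableD measurableT ir is_).
rewrite -!RintegralD// -RintegralB//; apply: le_Rintegral => //.
exact: (integrableB measurableT ipq irs).
Qed.

End integral_lemmas.

(** * The backward difference identity *)

Section bdf2_identity.
Context (R : realType).

(** The gap between the two sides is the square of the second difference
    a - 2 b + c, the numerical dissipation of the formula. *)
Lemma bdf2_le (a b c : R) :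
  a * a + (2 * a - b) * (2 * a - b)
    - (b * b + (2 * b - c) * (2 * b - c)) <= 2 * (a * (3 * a - 4 * b + c)).
Proof. by have := sqr_ge0 (a - 2 * b + c); nra. Qed.

Lemma bdf2_le_dotv n (a b c : 'rV[R]_n) :
  dotv a a + dotv (2 *: a - b) (2 *: a - b)
    - (dotv b b + dotv (2 *: b - c) (2 *: b - c))
  <= 2 * dotv a (3 *: a - 4 *: b + c).
Proof.
rewrite /dotv mulr_sumr -!big_split/= -sumrB; apply: ler_sum => i _.
by rewrite !mxE; exact: bdf2_le.
Qed.

End bdf2_identity.

(** * Square integrability and the energy norms *)

Section spaces.
Context (R : realType) (d : nat) (Q : box R d).
Implicit Types (a b c : L2per Q) (u v w : H1per Q).

Lemma L2per_Lfun a : (a : 'rV[R]_d -> R) \in Lfun (box_measure Q) 2%:E.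
Proof. by have /asboolP[] := valP a. Qed.

Lemma H1per_Lfun u : (u : 'rV[R]_d -> R) \in Lfun (box_measure Q) 2%:E.
Proof. by have /asboolP[/asboolP[]] := valP u. Qed.

Lemma grad_Lfun u i :
  (fun x => grad u x 0 i) \in Lfun (box_measure Q) 2%:E.
Proof. by have /asboolP[_ /(_ i)/asboolP[]] := valP u. Qed.

Lemma measurable_Lfun2 (f : 'rV[R]_d -> R) :
  f \in Lfun (box_measure Q) 2%:E -> measurable_fun setT f.
Proof. by move=> /sub_Lfun_mfun; rewrite inE. Qed.

Lemma measurable_L2per a : measurable_fun setT (a : 'rV[R]_d -> R).
Proof. exact: measurable_Lfun2 (L2per_Lfun a). Qed.

Lemma measurable_H1per u : measurable_fun setT (u : 'rV[R]_d -> R).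
Proof. exact: measurable_Lfun2 (H1per_Lfun u). Qed.

Lemma measurable_grad u i : measurable_fun setT (fun x => grad u x 0 i).
Proof. exact: measurable_Lfun2 (grad_Lfun u i). Qed.

Lemma integrable_L2perM a b :
  (box_measure Q).-integrable setT (EFin \o (fun x => a x * b x)).
Proof. exact: integrable_mul2 (L2per_Lfun a) (L2per_Lfun b). Qed.

Lemma L2per_bdf2E a b c x :
  (3 *: a - 4 *: b + c) x = 3 * a x - 4 * b x + c x.
Proof. by []. Qed.

Lemma H1per_bdf2E u v w x :
  (3 *: u - 4 *: v + w) x = 3 * u x - 4 * v x + w x.
Proof. by []. Qed.

Lemma H1per_extrapolateE u v x : (2 *: u - v) x = 2 * u x - v x.
Proof. by []. Qed.

Lemma measurable_dotv (F G : 'rV[R]_d -> 'rV[R]_d) :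
  (forall i, measurable_fun setT (fun x => F x 0 i)) ->
  (forall i, measurable_fun setT (fun x => G x 0 i)) ->
  measurable_fun setT (fun x => dotv (F x) (G x)).
Proof.
move=> mF mG; rewrite /dotv.
have mFG i : measurable_fun setT (fun x => F x 0 i * G x 0 i).
  by have := measurable_funM (mF i) (mG i).
exact: measurable_sum.
Qed.

(** A power of dotv p p covers the case p = 0 without a test, since it is
    multiplied by p there; measurability of Z is then a matter of composition. *)
Lemma Z_powR (p : 'rV[R]_d) : Z p = dotv p p `^ (- 2^-1) *: p.
Proof.
rewrite /Z; case: eqP => [->|_]; first by rewrite scaler0.
by rewrite powRN powR12_sqrt// sumr_ge0// => i _; rewrite -expr2 sqr_ge0.
Qed.

Lemma measurable_Z (F : 'rV[R]_d -> 'rV[R]_d) i :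
  (forall i, measurable_fun setT (fun x => F x 0 i)) ->
  measurable_fun setT (fun x => Z (F x) 0 i).
Proof.
move=> mF; under eq_fun do rewrite Z_powR mxE.
apply: measurable_funM => //.
exact: (measurableT_comp (measurable_powR _) (measurable_dotv mF mF)).
Qed.

Lemma integrable_dotv (F G : 'rV[R]_d -> 'rV[R]_d) :
  (forall i, (fun x => F x 0 i) \in Lfun (box_measure Q) 2%:E) ->
  (forall i, (fun x => G x 0 i) \in Lfun (box_measure Q) 2%:E) ->
  (box_measure Q).-integrable setT (EFin \o (fun x => dotv (F x) (G x))).
Proof.
move=> lF lG.
rewrite (_ : _ \o _ = fun x => (\sum_i (F x 0 i * G x 0 i)%:E)%E).
  by apply: integrable_sum => // i _; exact: integrable_mul2.
by apply/funext => x; rewrite /= /dotv -sumEFin.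
Qed.

Lemma innerC (f g : 'rV[R]_d -> R) : inner Q f g = inner Q g f.
Proof. by apply: eq_Rintegral => x _; rewrite mulrC. Qed.

Lemma inner_scale k (f g : 'rV[R]_d -> R) :
  f \in Lfun (box_measure Q) 2%:E -> g \in Lfun (box_measure Q) 2%:E ->
  inner Q (fun x => k * f x) g = k * inner Q f g.
Proof.
move=> lf lg; rewrite /inner -RintegralZl//; last exact: integrable_mul2.
by apply: eq_Rintegral => x _; rewrite mulrA.
Qed.

Lemma sqr_norm (f : 'rV[R]_d -> R) : norm Q f ^+ 2 = inner Q f f.
Proof. by rewrite sqr_sqrtr// Rintegral_ge0// => x _; rewrite -expr2 sqr_ge0. Qed.

Lemma sqr_normv (F : 'rV[R]_d -> 'rV[R]_d) : normv Q F ^+ 2 = innerv Q F F.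
Proof.
rewrite sqr_sqrtr// Rintegral_ge0// => x _.
by apply: sumr_ge0 => i _; rewrite -expr2 sqr_ge0.
Qed.

(** The space operations on L2per and H1per unfold to the pointwise ones, so
    the pointwise inequality applies to the integrands as they stand. *)
Lemma bdf2_le_norm a b c :
  norm Q a ^+ 2 + norm Q (2 *: a - b : L2per Q) ^+ 2
    - (norm Q b ^+ 2 + norm Q (2 *: b - c : L2per Q) ^+ 2)
  <= 2 * inner Q a (3 *: a - 4 *: b + c : L2per Q).
Proof.
have iM := integrable_L2perM.
rewrite !sqr_norm /inner -RintegralZl//.
apply: le_Rintegral_sumB => //; first exact: integrable_scale.
by move=> x; exact: bdf2_le.
Qed.

Lemma bdf2_le_normv u v w :
  normv Q (grad u) ^+ 2 + normv Q (2 *: grad u - grad v) ^+ 2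
    - (normv Q (grad v) ^+ 2 + normv Q (2 *: grad v - grad w) ^+ 2)
  <= 2 * innerv Q (grad u) (grad (3 *: u - 4 *: v + w)).
Proof.
have iM (f g : H1per Q) := integrable_dotv (grad_Lfun f) (grad_Lfun g).
rewrite !sqr_normv /innerv -RintegralZl//.
apply: le_Rintegral_sumB => //.
- exact: (iM (2 *: u - v) (2 *: u - v)).
- exact: (iM (2 *: v - w) (2 *: v - w)).
- exact: integrable_scale.
by move=> x; exact: bdf2_le_dotv.
Qed.

End spaces.

(** * Consequences of the scheme *)

Section scheme.
Context (R : realType) (d : nat) (Q : box R d).
Context (eps alpha beta M1 M2 eh B dt : R) (s0 s1 s2 : state Q).
Context (mu_phi mu_rho : H1per Q).
Context (scheme :
  bdf2_scheme eps alpha beta M1 M2 eh B dt s0 s1 s2 mu_phi mu_rho).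

Local Notation Dphi := (3 *: phi s2 - 4 *: phi s1 + phi s0 : H1per Q).
Local Notation Drho := (3 *: rho s2 - 4 *: rho s1 + rho s0 : L2per Q).
Local Notation DU := (3 *: U s2 - 4 *: U s1 + U s0 : L2per Q).
Local Notation DV := (3 *: V s2 - 4 *: V s1 + V s0 : L2per Q).
Local Notation DW := (3 *: W s2 - 4 *: W s1 + W s0 : L2per Q).
Local Notation phistar := (2 *: phi s1 - phi s0 : H1per Q).

(** The update of U is the discrete form of U_t = 2 phi phi_t, which absorbs
    phi* D phi. *)
Lemma inner_phistar_U :
  inner Q (fun x => phistar x * U s2 x) Dphi = 2^-1 * inner Q (U s2) DU.
Proof.
have [mL mH] := (@measurable_L2per _ _ Q, @measurable_H1per _ _ Q).
rewrite /inner -RintegralZl//; last exact: integrable_L2perM.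
apply: ae_eq_Rintegral.
- by apply: measurable_funM => //; apply: measurable_funM.
- by apply: measurable_funM => //; apply: measurable_funM.
apply: filterS (U_eq scheme) => x Ux.
by rewrite L2per_bdf2E Ux H1per_bdf2E H1per_extrapolateE; field.
Qed.

(** The update of V replaces Z* . grad (D phi) by D rho - D V; the D rho part
    cancels against the term alpha V of mu_rho. *)
Lemma innerv_VZ :
  innerv Q (fun x => V s2 x *: Z (grad phistar x)) (grad Dphi) =
  inner Q (V s2) Drho - inner Q (V s2) DV.
Proof.
have mL := @measurable_L2per _ _ Q.
rewrite /innerv /inner -RintegralB//; try exact: integrable_L2perM.
apply: ae_eq_Rintegral.
- apply: measurable_dotv => i; last exact: measurable_grad.
  under eq_fun do rewrite mxE.
  by apply: measurable_funM => //; apply: measurable_Z; exact: measurable_grad.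
- by apply: measurable_funB; apply: measurable_funM.
apply: filterS (V_eq scheme) => x Vx.
rewrite -mulrBr !L2per_bdf2E Vx subKr /dotv mulr_sumr.
by apply: eq_bigr => i _; rewrite mxE mulrA.
Qed.

(** The update of W is the discrete form of W_t = H rho_t / 2; it replaces
    H* D rho by 2 D W, a measurable function whatever H is. *)
Lemma inner_mu_rho :
  inner Q mu_rho Drho =
  alpha * inner Q (V s2) Drho + 2 * beta * inner Q (W s2) DW.
Proof.
have [mL mH] := (@measurable_L2per _ _ Q, @measurable_H1per _ _ Q).
have iL := @integrable_L2perM _ _ Q.
rewrite /inner -!RintegralZl// -RintegralD//; try exact: integrable_scale.
apply: ae_eq_Rintegral.
- exact: measurable_funM.
- by apply: measurable_funD; do 2 apply: measurable_funM => //.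
apply: filterS2 (mu_rho_eq scheme) (W_eq scheme) => x -> Wx.
by rewrite !L2per_bdf2E Wx; field.
Qed.

Lemma inner_mu_phi_phi (dt_gt0 : 0 < dt) :
  inner Q mu_phi Dphi = - (2 * dt * M1) * normv Q (grad mu_phi) ^+ 2.
Proof.
have := phi_eq scheme mu_phi.
rewrite (inner_scale _ (H1per_Lfun Dphi) (H1per_Lfun mu_phi)) innerC -sqr_normv.
have dt0 : 2 * dt != 0 by rewrite mulf_neq0// gt_eqF.
by move=> /(congr1 ( *%R (2 * dt))); rewrite mulVKf// => ->; ring.
Qed.

Lemma inner_mu_rho_rho (dt_gt0 : 0 < dt) :
  inner Q mu_rho Drho = - (2 * dt * M2) * normv Q (grad mu_rho) ^+ 2.
Proof.
have := rho_eq scheme mu_rho.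
rewrite (inner_scale _ (L2per_Lfun Drho) (H1per_Lfun mu_rho)) innerC -sqr_normv.
have dt0 : 2 * dt != 0 by rewrite mulf_neq0// gt_eqF.
by move=> /(congr1 ( *%R (2 * dt))); rewrite mulVKf// => ->; ring.
Qed.

(** The factors match the energy: its weights eps/4, 1/(8 eps), alpha/4 and
    beta/2, after the factor 2 of the difference identity, are half of those
    here. *)
Lemma energy_balance (dt_gt0 : 0 < dt) :
  eps * innerv Q (grad (phi s2)) (grad Dphi)
    + (2 * eps)^-1 * inner Q (U s2) DU
    + alpha * inner Q (V s2) DV
    + 2 * beta * inner Q (W s2) DW =
  2 * dt * (- M1 * normv Q (grad mu_phi) ^+ 2 - M2 * normv Q (grad mu_rho) ^+ 2).
Proof.
have := mu_phi_eq scheme Dphi; rewrite inner_phistar_U innerv_VZ inner_mu_phi_phi//.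
have := inner_mu_rho; rewrite inner_mu_rho_rho//.
rewrite mulrA invfM [2^-1 * _]mulrC.
lra.
Qed.

End scheme.

Theorem theorem3p4 (R : realType) (d : nat) (Hd : d = 2%N \/ d = 3%N)
  (Q : box R d)
  (eps alpha beta M1 M2 : R)
  (eps_gt0 : 0 < eps) (alpha_gt0 : 0 < alpha) (beta_gt0 : 0 < beta)
  (M1_gt0 : 0 < M1) (M2_gt0 : 0 < M2)
  (eh B : R) (eh_gt0 : 0 < eh) (eh_lt : eh < 1 / 2)
  (B_gt0 : 0 < B) (GB_gt0 : forall r : R, 0 < flory_huggins eh r + B)
  (dt : R) (dt_gt0 : 0 < dt)
  (s0 s1 s2 : state Q) (mu_phi mu_rho : H1per Q)
  (scheme : bdf2_scheme eps alpha beta M1 M2 eh B dt s0 s1 s2 mu_phi mu_rho) :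
  dt^-1 * (energy eps alpha beta s2 s1 - energy eps alpha beta s1 s0) <=
  - M1 * normv Q (grad mu_phi) ^+ 2 - M2 * normv Q (grad mu_rho) ^+ 2.
Proof.
rewrite mulrC ler_pdivrMr//.
have balance := energy_balance scheme dt_gt0.
have eps8_ge0 : 0 <= (8 * eps)^-1 by rewrite invr_ge0 mulr_ge0// ltW.
have phi_le := ler_wpM2l (divr_ge0 (ltW eps_gt0) (ler0n R 4))
  (bdf2_le_normv (phi s2) (phi s1) (phi s0)).
have U_le := ler_wpM2l eps8_ge0 (bdf2_le_norm (U s2) (U s1) (U s0)).
have V_le := ler_wpM2l (divr_ge0 (ltW alpha_gt0) (ler0n R 4))
  (bdf2_le_norm (V s2) (V s1) (V s0)).
have W_le := ler_wpM2l (divr_ge0 (ltW beta_gt0) (ler0n R 2))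
  (bdf2_le_norm (W s2) (W s1) (W s0)).
(* Linear arithmetic needs the weights containing eps^-1 to share one atom. *)
have e2 : (2 * eps)^-1 = 4 * (8 * eps)^-1 by field; rewrite gt_eqF.
have e4 : (4 * eps)^-1 = 2 * (8 * eps)^-1 by field; rewrite gt_eqF.
rewrite e2 in balance.
rewrite /energy e4; lra.
Qed.
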